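(* Let $m\ge2$, let $\Omega\subset\mathbb R^m$ be open, $K=[-a,a]$ with $a>0$, and let $N\in C^1(\Omega\times K)$. Define $$\Pi_N(x,\lambda)=\int_{-a}^{\lambda}|\partial_sN(x,s)|^2\,ds,\qquad(x,\lambda)\in\Omega\times K.$$ For every $x\in\Omega$ and every $\lambda<\mu$ in $K$, $$\Pi_N(x,\lambda)=\Pi_N(x,\mu)\iff N(x,\cdot)\text{ is constant on }[\lambda,\mu].$$ Consequently, for every $x\in\Omega$ there exists a unique continuous function $\widehat N(x,\cdot):\Pi_N(x,K)\to\mathbb R$ such that $$N(x,\lambda)=\widehat N\bigl(x,\Pi_N(x,\lambda)\bigr),\qquad\lambda\in K.$$ The reduced normal flux $\widehat N$ is measurable in $x$.
   Context: $\Pi_N(x,K)=\{\Pi_N(x,\lambda):\lambda\in K\}$. The function $\widehat N$ is called the reduced normal flux. *)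

(* Defs.v *)
From HB Require Import structures.
From mathcomp Require Import all_boot all_order all_algebra.
From mathcomp Require Import all_classical all_reals all_analysis.

Set Implicit Arguments.
Unset Strict Implicit.
Unset Printing Implicit Defensive.
Import Order.TTheory GRing.Theory Num.Theory.
Import numFieldNormedType.Exports.

Local Open Scope classical_set_scope.
Local Open Scope ring_scope.

Section NormalFlux.
Context {R : realType} {m : nat}.
Implicit Types (Omega : set 'rV[R]_m) (a : R) (N : 'rV[R]_m -> R -> R).

Definition flux_interval a : set R := `[- a, a]%classic.

(* Difference quotients in s only use values of N x on K = [-a, a], so that the
   derivative in s is one-sided at the endpoints and nothing depends on the
   values of N outside Omega * K. *)
Definition quotient_s N (x : 'rV[R]_m) (s : R) : R -> R :=
  fun t => (N x t - N x s) / (t - s).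

Definition derivable_s a N (x : 'rV[R]_m) (s : R) : Prop :=
  cvg (quotient_s N x s t @[t --> within (flux_interval a) s^']).

Definition partial_s a N (x : 'rV[R]_m) (s : R) : R :=
  lim (quotient_s N x s t @[t --> within (flux_interval a) s^']).

Definition partial_x N (i : 'I_m) (x : 'rV[R]_m) (s : R) : R :=
  'D_(delta_mx 0 i) (N ^~ s) x.

Definition continuous_on_cylinder Omega a (F : 'rV[R]_m -> R -> R) : Prop :=
  {within Omega `*` flux_interval a, continuous (fun p => F p.1 p.2)}.

(* N is of class C^1 on Omega * K, for Omega open. *)
Definition C1_cylinder Omega a N : Prop :=
  [/\ continuous_on_cylinder Omega a N,
      forall x s, Omega x -> flux_interval a s -> derivable_s a N x s,
      forall i x s, Omega x -> flux_interval a s ->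
        derivable (N ^~ s) x (delta_mx 0 i),
      continuous_on_cylinder Omega a (partial_s a N)
    & forall i, continuous_on_cylinder Omega a (partial_x N i)].

Definition Pi_flux a N (x : 'rV[R]_m) (l : R) : R :=
  \int[lebesgue_measure]_(s in `[- a, l]) (`|partial_s a N x s| ^+ 2).

Definition Pi_range a N (x : 'rV[R]_m) : set R :=
  Pi_flux a N x @` flux_interval a.

(* g plays the role of the function \hat N(x, .) : Pi_N(x, K) -> R; only the
   values of g on Pi_range a N x matter. *)
Definition reduced_flux_at a N (x : 'rV[R]_m) (g : R -> R) : Prop :=
  {within Pi_range a N x, continuous g} /\
  forall l, flux_interval a l -> N x l = g (Pi_flux a N x l).

(* Points x of Omega at which \hat N(x, p) is defined. *)
Definition reduced_flux_dom Omega a N (p : R) : set 'rV[R]_m :=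
  [set x | Omega x /\ Pi_range a N x p].

(* R^m with its Borel sigma-algebra. *)
Definition borel_rV : measurableType _ :=
  g_sigma_algebraType (@open 'rV[R]_m).

(* measurable_fun D f is void when D is not measurable, hence the first
   conjunct. *)
Definition borel_measurable_on (D : set 'rV[R]_m) (f : 'rV[R]_m -> R) : Prop :=
  measurable (D : set borel_rV) /\ measurable_fun (D : set borel_rV) f.

End NormalFlux.

(* Main.v *)
Require Import Defs.
From mathcomp Require Import all_boot all_order all_algebra.
From mathcomp Require Import all_classical all_reals all_analysis.
From mathcomp Require Import measurable_realfun ring lra.
Import Order.TTheory GRing.Theory Num.Theory.
Import numFieldNormedType.Exports.
Local Open Scope classical_set_scope.
Local Open Scope ring_scope.

(** Fix [x] and write [f = N x], [E = Pi_flux a N x], so that [E] is a primitive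
of [f' ^+ 2].  Everything about a single [x] follows from the Cauchy-Schwarz
bound [(f mu - f l) ^+ 2 <= (mu - l) * (E mu - E l)]
([energy_cauchy_schwarz]).  If [E l = E mu], then [E], being nondecreasing, is
constant on [[l, mu]] and the bound forces [f] to be constant there; conversely
a constant [f] has [f' = 0], so [E] does not grow ([energy_eqP]).  The bound
also says that [f] is a function of [E] which is Hoelder continuous with
exponent 1/2: this is the reduced flux ([reduced_flux_exists]).

For the measurability in [x] with [p] fixed, the reduced flux satisfies
[c <= Nhat x p] exactly when some [l] in [K] has [Pi x l = p] and
[c <= N x l].  Since [Pi] and [N] are jointly continuous on [Omega `*` K], the
set of such pairs [(x, l)] is closed in [Omega `*` K]; since [K] is compact, its
projection is closed in the open set [Omega], hence Borel
([measurable_projection]).  The domain of [Nhat ^~ p] is a projection of the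
same kind.  Joint continuity of [Pi] ([Pi_flux_continuous]) comes from its
continuity in [l] together with the fact that [Pi y] is uniformly close to
[Pi x] for [y] near [x], which is the tube lemma applied to [partial_s]. *)

(** * The energy of a function of one variable *)

Section Energy.
Context {R : realType}.
Implicit Types (f df : R -> R) (a b l : R).

(** The squared absolute value makes [Pi_flux a N x] convertible to
[energy (- a) (partial_s a N x)]. *)
Definition energy a df l : R :=
  \int[lebesgue_measure]_(s in `[a, l]) (`|df s| ^+ 2).

Lemma is_derive_quotient f (s d : R) :
  (f t - f s) / (t - s) @[t --> s^'] --> d -> is_derive s 1 f d.
Proof.
move=> fd; apply/is_derive1_caratheodory.
exists (fun t => if t == s then d else (f t - f s) / (t - s)); split.
- move=> t; case: eqP => [->|/eqP ts]; first by rewrite !subrr mulr0.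
  by rewrite divfK// subr_eq0.
- apply/continuous_withinNx; rewrite eqxx; apply: cvg_trans fd.
  apply: near_eq_cvg; near=> t; rewrite ifF//; apply/negbTE.
  by near: t; exact: nbhs_dnbhs_neq.
- by rewrite eqxx.
Unshelve. all: by end_near. Qed.

Lemma energy_start a df : energy a df a = 0.
Proof. by rewrite /energy set_itv1 Rintegral_set1. Qed.

Context {f df : R -> R} {a b : R}.
Hypothesis ab : a < b.
Hypothesis f_cont : {within `[a, b], continuous f}.
Hypothesis df_cont : {within `[a, b], continuous df}.
Hypothesis f_derive : forall s, s \in `]a, b[ -> is_derive s 1 f (df s).

Let cont_sq : {within `[a, b], continuous (fun s => `|df s| ^+ 2)}.
Proof.
apply/subspace_continuousP => s sab.
have /subspace_continuousP/(_ _ sab)/cvg_norm ds := df_cont.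
exact: (cvgM ds ds).
Qed.

Let integrable_sq :
  lebesgue_measure.-integrable `[a, b] (EFin \o (fun s => `|df s| ^+ 2)).
Proof.
apply: continuous_compact_integrable; [exact: segment_compact|exact: cont_sq].
Qed.

Lemma energy_continuous : {within `[a, b], continuous (energy a df)}.
Proof. exact: (parameterized_integral_continuous (ltW ab) integrable_sq). Qed.

Lemma energy_is_derive s : s \in `]a, b[ ->
  is_derive s 1 (energy a df) (df s ^+ 2).
Proof.
move=> /[dup] sab; rewrite in_itv/= => /andP[as_ sb].
have [] := continuous_FTC1_closed sb integrable_sq as_.
  exact: (within_continuous_continuous ab).
move=> D; rewrite derive1E => E; apply: DeriveDef; first exact: D.
by rewrite E real_normK ?num_real.
Qed.

Let sub_oo l mu s : a <= l -> mu <= b -> s \in `]l, mu[ -> s \in `]a, b[.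
Proof.
rewrite !in_itv/= => al mub /andP[ls smu].
by rewrite (le_lt_trans al ls) (lt_le_trans smu mub).
Qed.

Let sub_cc l mu : a <= l -> mu <= b -> `[l, mu] `<=` `[a, b].
Proof. by move=> al mub; apply: subset_itvScc; rewrite bnd_simp. Qed.

(** The integral Cauchy-Schwarz inequality without integrals: for every [c],
the function [E - 2 c f + c ^+ 2 id] has derivative [(f' - c) ^+ 2 >= 0], so it
does not decrease from [l] to [mu]; this is optimal when [c] is the mean slope
of [f]. *)
Lemma energy_cauchy_schwarz l mu : a <= l -> l <= mu -> mu <= b ->
  (f mu - f l) ^+ 2 <= (mu - l) * (energy a df mu - energy a df l).
Proof.
move=> al; rewrite le_eqVlt => /predU1P[-> _|lmu mub].
  by rewrite !subrr mul0r expr0n.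
pose c := (f mu - f l) / (mu - l).
pose h := energy a df - (2 * c) *: f + (c ^+ 2) *: id.
have fc : f mu - f l = c * (mu - l) by rewrite divfK// subr_eq0 gt_eqF.
have h_derive s : s \in `]l, mu[ -> is_derive s 1 h ((df s - c) ^+ 2).
  move=> /(sub_oo _ _ _ al mub) sab.
  have Ed := energy_is_derive _ sab; have fd := f_derive _ sab.
  apply: is_derive_eq; rewrite /GRing.scale/=; ring.
have h_cont : {within `[l, mu], continuous h}.
  apply: continuous_subspaceW (sub_cc _ _ al mub) _.
  have /subspace_continuousP E_cont := energy_continuous.
  have /subspace_continuousP f_cont' := f_cont.
  apply/subspace_continuousP => s sab; apply: cvgD; last first.
    by apply: cvgZr; exact: cvg_within_filter.
  by apply: cvgB; [exact: E_cont|apply: cvgZr; exact: f_cont'].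
have [s _] := MVT lmu h_derive h_cont.
have : 0 <= (df s - c) ^+ 2 by exact: sqr_ge0.
have : 0 < mu - l by rewrite subr_gt0.
rewrite fc /h !fctE /GRing.scale/=.
have -> : f mu = f l + c * (mu - l) by rewrite -fc addrC subrK.
set E1 := energy _ _ _; set E0 := energy _ _ _; set q := _ ^+ 2.
move=> d0 q0 E.
suff -> : (c * (mu - l)) ^+ 2 = (mu - l) * (E1 - E0 - q * (mu - l)).
  rewrite ler_pM2l// gerBl mulr_ge0// ltW//.
rewrite -E; ring.
Qed.

Lemma energy_le l mu : a <= l -> l <= mu -> mu <= b ->
  energy a df l <= energy a df mu.
Proof.
move=> al; rewrite le_eqVlt => /predU1P[-> //|lmu mub].
rewrite -subr_ge0 -(pmulr_rge0 _ (_ : 0 < mu - l)) ?subr_gt0//.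
exact: le_trans (sqr_ge0 _) (energy_cauchy_schwarz _ _ al (ltW lmu) mub).
Qed.

(** A form of [energy_cauchy_schwarz] that is symmetric in [l] and [mu] and
whose constant does not depend on them. *)
Lemma sqr_increment_le l mu : l \in `[a, b] -> mu \in `[a, b] ->
  (f mu - f l) ^+ 2 <= (b - a) * `|energy a df mu - energy a df l|.
Proof.
wlog lmu : l mu / l <= mu => [H lab muab|].
  have [/H|/ltW/H] := leP l mu; first exact.
  by rewrite -sqrrN opprB distrC; exact.
rewrite !in_itv/= => /andP[al lb] /andP[amu mub].
apply: (le_trans (energy_cauchy_schwarz _ _ al lmu mub)).
apply: ler_pM; rewrite ?ler_norm ?subr_ge0 ?energy_le//.
exact: lerB.
Qed.

(** Left to right, [E] is trapped between equal values at each [s] in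
[[l, mu]], and [energy_cauchy_schwarz] gives [f s = f l].  Right to left, the
mean value theorem bounds the growth of [E] by a value of [f' ^+ 2] at an
interior point, where [f] is locally constant. *)
Lemma energy_eqP l mu : a <= l -> l < mu -> mu <= b ->
  energy a df l = energy a df mu <->
  exists c, forall s, l <= s <= mu -> f s = c.
Proof.
move=> al lmu mub; split=> [E|[c fc]].
  exists (f l) => s /andP[ls smu].
  have sb := le_trans smu mub.
  have Es : energy a df s = energy a df l.
    apply/le_anti.
    by rewrite (energy_le _ _ al ls sb) E energy_le// (le_trans al ls).
  have := energy_cauchy_schwarz _ _ al ls sb.
  rewrite Es subrr mulr0 => ?; apply/eqP; rewrite -subr_eq0 -sqrf_eq0.
  by rewrite eq_le sqr_ge0 andbT.
have E_derive s : s \in `]l, mu[ -> is_derive s 1 (energy a df) (df s ^+ 2).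
  by move=> /(sub_oo _ _ _ al mub); exact: energy_is_derive.
have [|s slmu] := MVT lmu E_derive.
  exact: continuous_subspaceW (sub_cc _ _ al mub) energy_continuous.
suff -> : df s = 0 by rewrite expr0n mul0r => /eqP; rewrite subr_eq0 => /eqP ->.
have sab := sub_oo _ _ _ al mub slmu.
have /@derive_val <- := f_derive _ sab.
rewrite (@near_eq_derive _ _ _ _ (cst c)) ?derive_cst//.
near=> t; apply: fc.
have : t \in `]l, mu[ by near: t; exact: near_in_itvoo.
by rewrite in_itv/= => /andP[/ltW -> /ltW ->].
Unshelve. all: by end_near. Qed.

End Energy.

(** * Continuous functions on a cylinder with compact fibre *)

Section Cylinder.
Context {R : realType} {m : nat} {Omega : set 'rV[R]_m} {a : R}.
Implicit Types (x y : 'rV[R]_m) (s t eps : R) (F N : 'rV[R]_m -> R -> R).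
Hypothesis Omega_open : open Omega.

Lemma cylinder_slice F x : continuous_on_cylinder Omega a F -> Omega x ->
  {within `[- a, a], continuous (F x)}.
Proof.
move=> /subspace_continuousP F_cont Ox; apply/subspace_continuousP => s Ks.
have /= F_xs := F_cont (x, s) (conj Ox Ks).
apply: (cvg_trans _ F_xs) => A /= [[U V]/= [xU sV] UVA].
apply: filterS sV => t Vt Kt; apply: (UVA (x, t)) => //; split => //.
exact: nbhs_singleton.
Qed.

(** [Omega] being open, every [y] near [x] belongs to it, which is why only
[t] remains constrained. *)
Lemma cylinder_near F x s eps : continuous_on_cylinder Omega a F ->
  Omega x -> flux_interval a s -> 0 < eps ->
  \forall t \near s & y \near x, flux_interval a t -> `|F x s - F y t| < eps.
Proof.
move=> /subspace_continuousP F_cont Ox Ks eps0.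
have /= /cvgrPdist_lt/(_ _ eps0) [[U V]/= [xU sV] UVA] :=
  F_cont (x, s) (conj Ox Ks).
exists (V, U `&` Omega).
  by split => //; apply: filterI => //; exact: open_nbhs_nbhs.
by case=> t y /= [Vt [Uy Oy]] Kt; exact: (UVA (y, t)).
Qed.

(** The tube lemma: by compactness of [K], the neighbourhoods of the points
[(x, s)] given by continuity contain a common neighbourhood of [x]. *)
Lemma cylinder_tube F x eps : continuous_on_cylinder Omega a F ->
  Omega x -> 0 < eps ->
  \forall y \near x, forall t, flux_interval a t -> `|F y t - F x t| < eps.
Proof.
move=> F_cont Ox eps0.
have /compact_near_coveringP/near_covering_withinP cover :=
  @segment_compact R (- a) a.
apply: (cover _ (nbhs x) (fun y t => `|F y t - F x t| < eps)) => s Ks.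
have eps20 : 0 < eps / 2 by rewrite divr_gt0.
have F_near := cylinder_near _ _ _ _ F_cont Ox Ks eps20.
have /subspace_continuousP/(_ _ Ks)/cvgrPdist_lt/(_ _ eps20) Fx_near :=
  cylinder_slice _ _ F_cont Ox.
case: F_near => -[V U] /= [sV xU] VUF.
exists (V `&` [set t | flux_interval a t -> `|F x s - F x t| < eps / 2], U).
  by split => //; exact: filterI.
case=> t y /= [[Vt xt] Uy] Kt.
have -> : F y t - F x t = (F x s - F x t) - (F x s - F y t) by ring.
rewrite (le_lt_trans (ler_normB _ _))// [eps]splitr ltrD//; first exact: xt.
exact: (VUF (t, y)).
Qed.

(** Projecting along a compact factor is a closed map, so the set below is
closed in [Omega]: its complement [W] in [Omega] is open by the tube lemma. *)
Lemma measurable_projection (T : topologicalType) (F : 'rV[R]_m -> R -> T)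
    (C : set T) :
  {within Omega `*` flux_interval a, continuous (fun p => F p.1 p.2)} ->
  closed C ->
  measurable ([set x | Omega x /\ exists2 l, flux_interval a l & C (F x l)]
    : set borel_rV).
Proof.
move=> F_cont C_closed.
pose W := [set x | Omega x /\ forall l, flux_interval a l -> (~` C) (F x l)].
have W_open : open W.
  rewrite openE => x [Ox Wx]; rewrite /interior/=.
  suff F_near :
      \forall y \near x, forall l, flux_interval a l -> (~` C) (F y l).
    by apply: filterI F_near; exact: open_nbhs_nbhs.
  have /compact_near_coveringP/near_covering_withinP cover :=
    @segment_compact R (- a) a.
  apply: (cover _ (nbhs x) (fun y l => (~` C) (F y l))) => l Kl.
  move/subspace_continuousP : F_cont => /(_ (x, l) (conj Ox Kl)) /= F_xl.
  have [|[U V]/= [xU lV] UVC] := F_xl (~` C).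
    by apply: open_nbhs_nbhs; split; [exact: closed_openC|exact: Wx].
  exists (V, U `&` Omega).
    by split => //; apply: filterI => //; exact: open_nbhs_nbhs.
  by case=> t y /= [Vt [Uy Oy]] Kt; exact: (UVC (y, t)).
have -> : [set x | Omega x /\ exists2 l, flux_interval a l & C (F x l)] =
    Omega `\` W.
  apply/seteqP; split=> x /= [Ox].
    by case=> l Kl Cl; split => // -[_ /(_ l Kl)].
  move=> nW; split => //; apply: contrapT => nE; apply: nW; split => // l Kl Cl.
  by apply: nE; exists l.
by apply: measurableD; exact: sub_sigma_algebra.
Qed.

End Cylinder.

(** * The flux and the reduced flux *)

Section Flux.
Context {R : realType} {m : nat} {Omega : set 'rV[R]_m} {a : R}.
Context {N : 'rV[R]_m -> R -> R}.
Hypotheses (Omega_open : open Omega) (a_gt0 : 0 < a).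
Hypothesis N_C1 : C1_cylinder Omega a N.

Let Na_lt_a : - a < a. Proof. by rewrite gtrN. Qed.

Let N_cont : continuous_on_cylinder Omega a N.
Proof. by case: N_C1. Qed.

Let dN_cont : continuous_on_cylinder Omega a (partial_s a N).
Proof. by case: N_C1. Qed.

(** At an interior point of [K] the punctured neighbourhoods eventually lie in
[K], so that the limit defining [partial_s] is the ordinary derivative. *)
Lemma partial_s_derive x s : Omega x -> s \in `]- a, a[ ->
  is_derive s 1 (N x) (partial_s a N x s).
Proof.
move=> Ox sK; apply: is_derive_quotient.
have Ks : flux_interval a s by exact: subset_itv_oo_cc sK.
have [_ /(_ x s Ox Ks) + _ _ _] := N_C1; rewrite /derivable_s => N_deriv.
apply: cvg_trans N_deriv => A; rewrite /= /nbhs/=.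
move=> KA; have : \forall t \near s^', flux_interval a t.
  apply: nbhs_dnbhs; apply: filterS (near_in_itvoo sK) => t.
  exact: subset_itv_oo_cc.
by move=> Kt; apply: filterS2 Kt KA => t Kt; exact.
Qed.

(** [Pi y - Pi x] vanishes at [- a] and its derivative is the difference of the
squared partial derivatives, which is uniformly small on [K] for [y] near [x];
the mean value theorem replaces a passage to the limit under the integral. *)
Lemma Pi_flux_tube x eps : Omega x -> 0 < eps ->
  \forall y \near x, forall l, flux_interval a l ->
    `|Pi_flux a N y l - Pi_flux a N x l| < eps.
Proof.
move=> Ox eps0.
pose q y s := partial_s a N y s ^+ 2.
have q_cont : continuous_on_cylinder Omega a q.
  move: dN_cont => /subspace_continuousP d_cont.
  apply/subspace_continuousP => p Kp.
  exact: cvgM (d_cont _ Kp) (d_cont _ Kp).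
(* [K] has length [2 * a], the factor lost in the mean value theorem. *)
have eps'0 : 0 < eps / (2 * a) by rewrite divr_gt0// mulr_gt0.
near=> y => l; rewrite /flux_interval/= in_itv/= => /andP[Nal la].
have Oy : Omega y by near: y; exact: open_nbhs_nbhs.
have h_derive s : s \in `]- a, l[ ->
    is_derive s 1 (Pi_flux a N y - Pi_flux a N x) (q y s - q x s).
  rewrite in_itv/= => /andP[as_ sl].
  have sK : s \in `]- a, a[ by rewrite in_itv/= as_ (lt_le_trans sl).
  have dy := cylinder_slice _ _ dN_cont Oy.
  have dx := cylinder_slice _ _ dN_cont Ox.
  exact: is_deriveB (energy_is_derive Na_lt_a dy s sK)
                    (energy_is_derive Na_lt_a dx s sK).
have Pi_cont z : Omega z -> {within `[- a, a], continuous (Pi_flux a N z)}.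
  move=> Oz.
  exact: energy_continuous Na_lt_a (cylinder_slice _ _ dN_cont Oz).
have h_cont : {within `[- a, l], continuous (Pi_flux a N y - Pi_flux a N x)}.
  have /continuous_subspaceW : `[- a, l] `<=` `[- a, a].
    by apply: subset_itvScc; rewrite bnd_simp.
  apply.
  have /subspace_continuousP y_cont := Pi_cont _ Oy.
  have /subspace_continuousP x_cont := Pi_cont _ Ox.
  apply/subspace_continuousP => s Ks.
  by apply: cvgB; [exact: y_cont|exact: x_cont].
have [s] := MVT_segment Nal h_derive h_cont.
rewrite in_itv/= !fctE /Pi_flux -!/(energy _ _ _) !energy_start subrr subr0.
rewrite opprK.
move=> /andP[as_ sl] ->.
have q_near : `|q y s - q x s| < eps / (2 * a).
  have : flux_interval a s.
    by rewrite /flux_interval/= in_itv/= as_ (le_trans sl).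
  move: s {as_ sl}; near: y.
  exact: (cylinder_tube Omega_open _ _ _ q_cont Ox eps'0).
have la0 : 0 <= l + a by lra.
rewrite normrM (ger0_norm la0).
apply: (@le_lt_trans _ _ (`|q y s - q x s| * (2 * a))).
  by rewrite ler_wpM2l//; lra.
by rewrite -ltr_pdivlMr// mulr_gt0.
Unshelve. all: by end_near. Qed.

Lemma Pi_flux_continuous : continuous_on_cylinder Omega a (Pi_flux a N).
Proof.
apply/subspace_continuousP => -[x l] /= [Ox Kl].
apply/cvgrPdist_lt => eps eps0.
have eps20 : 0 < eps / 2 by rewrite divr_gt0.
have tube := Pi_flux_tube _ _ Ox eps20.
have /subspace_continuousP/(_ _ Kl)/cvgrPdist_lt/(_ _ eps20) Px_near :
    {within `[- a, a], continuous (Pi_flux a N x)}.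
  by apply: energy_continuous => //; exact: cylinder_slice.
exists ([set y | forall t, flux_interval a t ->
                   `|Pi_flux a N y t - Pi_flux a N x t| < eps / 2],
        [set t | flux_interval a t ->
                   `|Pi_flux a N x l - Pi_flux a N x t| < eps / 2]) => //.
case=> y t /= [tube_y near_t] [Oy Kt].
have -> : Pi_flux a N x l - Pi_flux a N y t =
    (Pi_flux a N x l - Pi_flux a N x t) - (Pi_flux a N y t - Pi_flux a N x t).
  by ring.
rewrite (le_lt_trans (ler_normB _ _))// [eps]splitr ltrD//.
  exact: near_t.
exact: tube_y.
Qed.

Lemma sqr_flux_increment_le x l mu :
  Omega x -> flux_interval a l -> flux_interval a mu ->
  (N x mu - N x l) ^+ 2 <= (2 * a) * `|Pi_flux a N x mu - Pi_flux a N x l|.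
Proof.
move=> Ox Kl Kmu; have -> : 2 * a = a - - a by ring.
apply: (@sqr_increment_le _ (N x)) => //; first exact: cylinder_slice.
  exact: cylinder_slice.
by move=> s; exact: partial_s_derive.
Qed.

Lemma Pi_flux_eqP x l mu : Omega x -> flux_interval a l -> flux_interval a mu ->
  l < mu ->
  Pi_flux a N x l = Pi_flux a N x mu <->
  exists c, forall s, l <= s <= mu -> N x s = c.
Proof.
rewrite /flux_interval/= !in_itv/= => Ox /andP[Nal _] /andP[_ mua] lmu.
apply: (@energy_eqP _ (N x) _ (- a) a) => //; first exact: cylinder_slice.
  exact: cylinder_slice.
by move=> s; exact: partial_s_derive.
Qed.

(** The value at [p] is [N x l] for a chosen [l] with [Pi x l = p].
[sqr_flux_increment_le] shows both that the choice is irrelevant and that the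
result is Hoelder continuous with exponent 1/2. *)
Lemma reduced_flux_exists x : Omega x -> exists g, reduced_flux_at a N x g.
Proof.
move=> Ox.
pose sel p := get [set l | flux_interval a l /\ Pi_flux a N x l = p].
have selP p : Pi_range a N x p ->
    flux_interval a (sel p) /\ Pi_flux a N x (sel p) = p.
  move=> [l Kl Pl].
  by apply: (@getPex _ [set l | flux_interval a l /\ _]); exists l.
exists (N x \o sel); split=> [|l Kl]; last first.
  have [Ks Ps] := selP _ (imageP _ Kl).
  have := sqr_flux_increment_le _ _ _ Ox Kl Ks.
  rewrite Ps subrr normr0 mulr0 => N0.
  apply/esym/eqP; rewrite -subr_eq0 -sqrf_eq0 eq_le sqr_ge0 andbT.
  exact: N0.
apply/subspace_continuousP => p /selP[Kp Pp].
apply/cvgrPdist_lt => eps eps0.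
(* The radius inverts the Hoelder modulus [sqrt (2 * a * _)]. *)
have d0 : 0 < eps ^+ 2 / (2 * a) by rewrite divr_gt0 ?exprn_gt0 ?mulr_gt0.
have : \forall q \near p, `|p - q| < eps ^+ 2 / (2 * a).
  by have /cvgrPdist_lt := @cvg_id _ (nbhs p); exact.
apply: filterS => q pq /selP[Kq Pq].
change (`|N x (sel p) - N x (sel q)| < eps).
rewrite -(@ltr_pXn2r _ 2) ?nnegrE ?normr_ge0 ?ltW// real_normK ?num_real//.
apply: le_lt_trans (sqr_flux_increment_le _ _ _ Ox Kq Kp) _.
by rewrite Pp Pq mulrC -ltr_pdivlMr// mulr_gt0.
Qed.

(** Both the domain and the sets of [x] with [c <= Nhat x p] are
projections covered by [measurable_projection]: any [l] with [Pi x l = p]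
computes [Nhat x p] as [N x l]. *)
Lemma reduced_flux_measurable (Nhat : 'rV[R]_m -> R -> R) (p : R) :
  (forall x, Omega x -> reduced_flux_at a N x (Nhat x)) ->
  borel_measurable_on (reduced_flux_dom Omega a N p) (Nhat ^~ p).
Proof.
move=> NhatP; split.
  exact: measurable_projection Omega_open _ _ _ Pi_flux_continuous
    (@closed_eq _ p).
apply: (measurability (@RGenCInfty.G R)) => [|/= _ [_] [c] -> <-].
  exact: RGenCInfty.measurableE.
pose C := [set z : R * R | z.1 = p /\ c <= z.2].
have C_closed : closed C.
  rewrite (_ : C = fst @^-1` [set p] `&` snd @^-1` [set t | c <= t])//.
  apply: closedI.
    by apply: preimage_closed; [move=> z _; exact: cvg_fst|exact: closed_eq].
  by apply: preimage_closed; [move=> z _; exact: cvg_snd|exact: closed_ge].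
have PN_cont : {within Omega `*` flux_interval a,
    continuous (fun z => (Pi_flux a N z.1 z.2, N z.1 z.2))}.
  have /subspace_continuousP P_cont := Pi_flux_continuous.
  have /subspace_continuousP N_cont' := N_cont.
  apply/subspace_continuousP => z Kz.
  exact: cvg_pair (P_cont z Kz) (N_cont' z Kz).
have := measurable_projection Omega_open _
  (fun x l => (Pi_flux a N x l, N x l)) _ PN_cont C_closed.
congr (measurable _); apply/seteqP; split=> x /=.
  move=> [Ox [l Kl [/= Pl cN]]]; have [_ Nl] := NhatP _ Ox.
  split; first by split => //; exists l.
  by rewrite in_itv/= andbT -Pl -Nl.
move=> [[Ox [l Kl Pl]]]; rewrite in_itv/= andbT => cN; split => //.
have [_ Nl] := NhatP _ Ox.
by exists l => //; split => //=; rewrite Nl// Pl.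
Qed.

End Flux.

Theorem lemma2p11 (R : realType) (m : nat) (Omega : set 'rV[R]_m) (a : R)
    (N : 'rV[R]_m -> R -> R) (hm : (2 <= m)%N) (hOmega : open Omega)
    (ha : 0 < a) (hN : C1_cylinder Omega a N) :
  [/\ forall x l mu, Omega x -> flux_interval a l -> flux_interval a mu ->
        l < mu ->
        (Pi_flux a N x l = Pi_flux a N x mu <->
         exists c, forall s, l <= s <= mu -> N x s = c),
      forall x, Omega x ->
        exists g : R -> R, reduced_flux_at a N x g /\
          forall h : R -> R, reduced_flux_at a N x h ->
            {in Pi_range a N x, h =1 g}
    & forall Nhat : 'rV[R]_m -> R -> R,
        (forall x, Omega x -> reduced_flux_at a N x (Nhat x)) ->
        forall p : R,
          borel_measurable_on (reduced_flux_dom Omega a N p) (Nhat ^~ p)].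
Proof.
split=> [x l mu|x Ox|Nhat NhatP p].
- exact: Pi_flux_eqP.
- have [g gP] := reduced_flux_exists ha hN _ Ox.
  exists g; split => // h [_ hN'] p /set_mem[l Kl <-].
  by have [_ gN] := gP; rewrite -hN'// -gN.
- exact: reduced_flux_measurable.
Qed.
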